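(* Let $(M,d)$ be a metric space, $(E,\rho)$ a complete metric space and $T:M\to E$ a $K$-Lipschitz map with $K>0$. Let $(M_T,\overline d_T)$, $j:M\to M_T$ and $\overline T:M_T\to E$ be the canonical complete metric space, $1$-Lipschitz inclusion/quotient map and $K$-Lipschitz map with $T=\overline T\circ j$ defined in the context. Then this factorization is maximal in the following sense. Suppose that there is another complete metric space $(J,\overline\rho)$ such that (i) $T$ can be factored as $T=T_0\circ i_0$, where $T_0:J\to E$ is a $K$-Lipschitz map and $i_0:M\to J$ is a $1$-Lipschitz inclusion/quotient map, and (ii) $i_0(M)$ is dense in $J$. Then there is a $1$-Lipschitz inclusion/quotient map $i:J\to M_T$ satisfying (1) $i\circ i_0=j$, and (2) $\overline T\circ i=T_0$.
   Context: A map $f$ between metric spaces $(X,d_X)$ and $(Z,d_Z)$ is $K$-Lipschitz if $d_Z(f(x),f(y))\le K\,d_X(x,y)$ for all $x,y\in X$ and $K$ is the smallest constant satisfying this inequality. For metric spaces $M$ and $N$, a map $j:M\to N$ is an inclusion/quotient map if $j(M)$ is dense in $N$ and there is an equivalence relation on $M$ such that $j(x)=j(y)$ whenever $x,y$ belong to the same equivalence class; that is, $j$ is a quotient map onto a dense subspace of $N$. Construction of $M_T$, $j$, $\overline T$: put $d_T(x,y)=\frac1K\rho(T(x),T(y))$ for $x,y\in M$, a pseudometric on $M$. Let $[x]=\{y\in M: d_T(x,y)=0\}$, $M^*=\{[x]:x\in M\}$, with metric $d_T^*([x],[y])=d_T(x,y)$. Let $(M_T,\overline d_T)$ be the completion of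 $(M^*,d_T^* )$, let $j:M\to M_T$ be the map $x\mapsto[x]$ followed by the isometric inclusion $M^*\to M_T$, and let $\overline T:M_T\to E$ be the extension by continuity of the map $T^*:M^*\to E$, $T^*([x])=T(x)$. *)

(* Defs.v *)
From HB Require Import structures.
From mathcomp Require Import all_boot all_order all_algebra.
From mathcomp Require Import generic_quotient.
From mathcomp Require Import all_classical all_reals all_analysis.

Set Implicit Arguments.
Unset Strict Implicit.
Unset Printing Implicit Defensive.

Import Order.TTheory GRing.Theory Num.Theory.
Import numFieldNormedType.Exports.
Import metricType_numDomainType.

Local Open Scope quotient_scope.
Local Open Scope classical_set_scope.
Local Open Scope ring_scope.

(* The library's [_.-lipschitz] needs normed modules and does not ask for the
   best constant. *)
Definition lipschitz_bound (R : realType) (X Z : metricType R) (K : R)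
    (f : X -> Z) : Prop :=
  forall x y, mdist (f x) (f y) <= K * mdist x y.

Definition is_lipschitz (R : realType) (X Z : metricType R) (K : R)
    (f : X -> Z) : Prop :=
  lipschitz_bound K f /\ forall K', lipschitz_bound K' f -> K <= K'.

(* The axiom of [completeType], which cannot be used directly because it also
   carries a distinguished point. *)
Definition complete_metric (R : realType) (X : metricType R) : Prop :=
  forall F : set_system X, ProperFilter F -> cauchy F -> exists l : X, F --> l.

(* "Quotient map" is meant for sets: the classes of the relation are the
   fibres of [j], so that [j] induces a bijection from the set of classes onto
   the dense subspace [range j]. It is not the topological notion: [range j]
   keeps the metric of [N], whose topology may be strictly coarser than the
   quotient topology. *)
Definition inclusion_quotient (R : realType) (M N : metricType R)
    (j : M -> N) : Prop :=
  dense (range j) /\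
  exists r : equiv_rel M, forall x y, r x y <-> j x = j y.

Record pseudometric (R : realType) (X : Type) := Pseudometric {
  pdist :> X -> X -> R;
  pdistxx : forall x, pdist x x = 0;
  pdist_sym : forall x y, pdist x y = pdist y x;
  pdist_triangle : forall y x z, pdist x z <= pdist x y + pdist y z
}.

Section MetricQuotient.
Context (R : realType) (X : choiceType) (d : pseudometric R X).

Lemma pdist_ge0 x y : 0 <= d x y.
Proof.
rewrite -(@pmulrn_lge0 _ _ 2)// -(pdistxx d x).
by rewrite (le_trans (pdist_triangle d y _ _))// pdist_sym -mulr2n.
Qed.

Definition pdist0 : rel X := fun x y => d x y == 0.

Lemma pdist0_refl : reflexive pdist0.
Proof. by move=> x; rewrite /pdist0 pdistxx. Qed.

Lemma pdist0_sym : symmetric pdist0.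
Proof. by move=> x y; rewrite /pdist0 pdist_sym. Qed.

Lemma pdist0_trans : transitive pdist0.
Proof.
move=> y x z /eqP xy /eqP yz; rewrite /pdist0 eq_le pdist_ge0 andbT.
by rewrite (le_trans (pdist_triangle d y _ _))// xy yz addr0.
Qed.

Canonical pdist0_equiv : equiv_rel X :=
  EquivRel pdist0 pdist0_refl pdist0_sym pdist0_trans.

Definition metric_quotient : Type := {eq_quot pdist0_equiv}.

HB.instance Definition _ := Choice.on metric_quotient.

Definition quotient_class (x : X) : metric_quotient := \pi_{eq_quot pdist0_equiv} x.

Definition quotient_repr (p : metric_quotient) : X :=
  repr (p : {eq_quot pdist0_equiv}).

Lemma quotient_reprK p : quotient_class (quotient_repr p) = p.
Proof. exact: reprK. Qed.

Lemma quotient_classE x y : quotient_class x = quotient_class y <-> d x y = 0.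
Proof.
split=> [/eqmodP/eqP//|xy].
by apply/eqmodP; rewrite /= /pdist0 xy.
Qed.

Lemma pdist_repr x : d (quotient_repr (quotient_class x)) x = 0.
Proof. by apply/quotient_classE; rewrite quotient_reprK. Qed.

Definition quotient_dist (p q : metric_quotient) : R :=
  d (quotient_repr p) (quotient_repr q).

Lemma quotient_distE x y :
  quotient_dist (quotient_class x) (quotient_class y) = d x y.
Proof.
rewrite /quotient_dist; set x' := quotient_repr _; set y' := quotient_repr _.
have x'x : d x' x = 0 by exact: pdist_repr.
have y'y : d y' y = 0 by exact: pdist_repr.
apply/eqP; rewrite eq_le; apply/andP; split.
  rewrite (le_trans (pdist_triangle d x _ _))// x'x add0r.
  by rewrite (le_trans (pdist_triangle d y _ _))// (pdist_sym d y) y'y addr0.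
rewrite (le_trans (pdist_triangle d x' _ _))// (pdist_sym d x) x'x add0r.
by rewrite (le_trans (pdist_triangle d y' _ _))// y'y addr0.
Qed.

Let qdistxx p : quotient_dist p p = 0.
Proof. exact: pdistxx. Qed.

Let qdist_pos p q : quotient_dist p q = 0 -> p = q.
Proof. by rewrite -[p]quotient_reprK -[q]quotient_reprK quotient_distE => /quotient_classE. Qed.

Let qdist_sym p q : quotient_dist p q = quotient_dist q p.
Proof. exact: pdist_sym. Qed.

Let qdist_triangle q p r :
  quotient_dist p r <= quotient_dist p q + quotient_dist q r.
Proof. exact: pdist_triangle. Qed.

HB.instance Definition _ := @isMetric.Build R metric_quotient
  quotient_dist qdistxx qdist_pos qdist_sym qdist_triangle.

Lemma mdist_class x y : mdist (quotient_class x) (quotient_class y) = d x y.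
Proof. exact: quotient_distE. Qed.

End MetricQuotient.

(* The completion as the space of Cauchy sequences modulo the pseudometric
   lim_n mdist (u n) (v n). *)
Section Completion.
Context (R : realType) (X : metricType R).

Definition cauchy_sequence : Type := {u : nat -> X | `[< cauchy (u @ \oo) >]}.

HB.instance Definition _ := Choice.on cauchy_sequence.

Definition seq_of (u : cauchy_sequence) : nat -> X := sval u.

Definition cauchy_seq (u : nat -> X) (cu : cauchy (u @ \oo)) : cauchy_sequence :=
  exist (fun v : nat -> X => `[< cauchy (v @ \oo) >]) u (asboolT cu).

Definition mdist_seq (u v : cauchy_sequence) : nat -> R :=
  fun n => mdist (seq_of u n) (seq_of v n).

Lemma cauchy_mdistP (u : nat -> X) : cauchy (u @ \oo) <->
  forall e, 0 < e -> exists N, forall m n, (N <= m)%N -> (N <= n)%N ->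
    mdist (u m) (u n) < e.
Proof.
split=> [/cauchy_ballP cu e e0|cu].
  have [[A B] [/= [N _ NA] [N' _ NB]] AB] := cu _ e0.
  exists (maxn N N') => m n; rewrite !geq_max => /andP[Nm _] /andP[_ Nn].
  have /= := AB (u m, u n); rewrite ballEmdist; apply; split.
    exact: NA.
  exact: NB.
apply/cauchy_ballP => e e0; have [N Nu] := cu _ e0.
exists ([set x | exists2 n, (N <= n)%N & x = u n],
        [set x | exists2 n, (N <= n)%N & x = u n]).
  by split; exists N => // n /= Nn; exists n.
by move=> [x y] /= [[m Nm ->] [n Nn ->]]; rewrite ballEmdist; exact: Nu.
Qed.

Lemma seq_cauchy (u : cauchy_sequence) : cauchy (seq_of u @ \oo).
Proof. by case: u => u /= /asboolP. Qed.

Lemma mdist_quad (x y x' y' : X) :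
  `|mdist x y - mdist x' y'| <= mdist x x' + mdist y y'.
Proof.
have h (a b a' b' : X) : mdist a b - mdist a' b' <= mdist a a' + mdist b b'.
  rewrite lerBlDr (le_trans (metric_triangle _ a' _))// -addrA lerD2l.
  by rewrite (le_trans (metric_triangle _ b' _))// addrC (metric_sym b).
rewrite ler_norml h andbT lerNl opprB (le_trans (h _ _ x y))//.
by rewrite (metric_sym x) (metric_sym y).
Qed.

Lemma mdist_seq_cvg u v : cvg (mdist_seq u v @ \oo).
Proof.
apply/cauchy_cvgP/cauchy_exP => e e0; have e2 : 0 < e / 2 by rewrite divr_gt0.
have [N Nu] := (cauchy_mdistP _).1 (seq_cauchy u) _ e2.
have [N' Nv] := (cauchy_mdistP _).1 (seq_cauchy v) _ e2.
exists (mdist_seq u v (maxn N N')); exists (maxn N N') => // n /= Nn.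
rewrite /ball/= (le_lt_trans (mdist_quad _ _ _ _))// (splitr e) ltrD//.
  by apply: Nu; rewrite ?leq_maxl// (leq_trans _ Nn)// leq_maxl.
by apply: Nv; rewrite ?leq_maxr// (leq_trans _ Nn)// leq_maxr.
Qed.

Definition seq_dist (u v : cauchy_sequence) : R := lim (mdist_seq u v @ \oo).

Let seq_distxx u : seq_dist u u = 0.
Proof.
rewrite /seq_dist (_ : mdist_seq u u = fun=> 0) ?lim_cst//.
by apply/funext => n; rewrite /mdist_seq mdistxx.
Qed.

Let seq_dist_sym u v : seq_dist u v = seq_dist v u.
Proof.
rewrite /seq_dist; congr (lim (_ @ \oo)).
by apply/funext => n; rewrite /mdist_seq metric_sym.
Qed.

Let seq_dist_triangle v u w : seq_dist u w <= seq_dist u v + seq_dist v w.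
Proof.
rewrite /seq_dist -limD; [|exact: mdist_seq_cvg..].
apply: ler_lim; [exact: mdist_seq_cvg| |].
  by apply: is_cvgD; exact: mdist_seq_cvg.
by apply: nearW => n; exact: metric_triangle.
Qed.

Definition seq_pseudometric : pseudometric R cauchy_sequence :=
  Pseudometric seq_distxx seq_dist_sym seq_dist_triangle.

Definition completion : Type := metric_quotient seq_pseudometric.

HB.instance Definition _ := Metric.on completion.

Definition class_of_seq (u : cauchy_sequence) : completion :=
  quotient_class seq_pseudometric u.

Lemma cst_cauchy (x : X) : cauchy ((fun _ : nat => x) @ \oo).
Proof. by apply/cauchy_mdistP => e e0; exists 0%N => *; rewrite mdistxx. Qed.

Definition cst_seq (x : X) : cauchy_sequence := cauchy_seq (cst_cauchy x).

Definition completion_inc (x : X) : completion := class_of_seq (cst_seq x).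

Lemma mdist_class_of_seq u v :
  mdist (class_of_seq u) (class_of_seq v) = lim (mdist_seq u v @ \oo).
Proof. exact: mdist_class. Qed.

Lemma completion_inc_isometry x y :
  mdist (completion_inc x) (completion_inc y) = mdist x y.
Proof. by rewrite mdist_class_of_seq /mdist_seq /= lim_cst. Qed.

Lemma completion_inc_cvg (u : cauchy_sequence) (e : R) : 0 < e ->
  exists N, forall n, (N <= n)%N ->
    mdist (completion_inc (seq_of u n)) (class_of_seq u) <= e.
Proof.
move=> e0; have [N Nu] := (cauchy_mdistP _).1 (seq_cauchy u) _ e0.
exists N => n Nn; rewrite mdist_class_of_seq.
apply: limr_le; first exact: mdist_seq_cvg.
by exists N => // m /= Nm; rewrite ltW// Nu.
Qed.

Lemma completion_classP (z : completion) : exists u, z = class_of_seq u.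
Proof. by exists (quotient_repr z); rewrite /class_of_seq quotient_reprK. Qed.

Lemma completion_inc_approx (z : completion) (e : R) : 0 < e ->
  exists x, mdist (completion_inc x) z < e.
Proof.
move=> e0; have [u ->] := completion_classP z.
have [|N Nu] := @completion_inc_cvg u (e / 2); first by rewrite divr_gt0.
exists (seq_of u N); rewrite (le_lt_trans (Nu _ (leqnn _)))//.
by rewrite ltr_pdivrMr// ltr_pMr// ltr1n.
Qed.

Lemma completion_inc_dense : dense (range completion_inc).
Proof.
move=> O [z Oz] Oo; have /nbhs_ballP[e /= e0 eO] : nbhs z O by exact: open_nbhs_nbhs.
have [x xz] := completion_inc_approx z e0.
exists (completion_inc x); split; last by exists x.
by apply: eO; rewrite ballEmdist /= metric_sym.
Qed.

Lemma completion_complete : complete_metric completion.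
Proof.
move=> F FF /cauchyP cF.
pose eps n : R := n.+1%:R^-1.
have eps0 n : 0 < eps n by rewrite invr_gt0 ltr0n.
have epsle m n : (m <= n)%N -> eps n <= eps m.
  by move=> mn; rewrite lef_pV2 ?posrE ?ltr0n// ler_nat ltnS.
have epslt (e : R) : 0 < e -> exists N, eps N < e.
  move=> e0; exists (Num.truncn e^-1).
  by rewrite invf_plt ?posrE// -?truncnS_gt// truncnS_gt.
have /choice[x xF] n : exists x, F (ball (completion_inc x) (eps n)).
  have e2 : 0 < eps n / 2 by rewrite divr_gt0.
  have [c cn] := cF _ e2; have [x xc] := completion_inc_approx c e2.
  exists x; apply: filterS cn => w; rewrite !ballEmdist /= => cw.
  by rewrite (le_lt_trans (metric_triangle _ c _))// (splitr (eps n)) ltrD.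
have xmn m n : mdist (x m) (x n) < eps m + eps n.
  have [w [wm wn]] := filter_ex (filterI (xF m) (xF n)).
  move: wm wn; rewrite !ballEmdist /= => wm wn.
  rewrite -completion_inc_isometry (le_lt_trans (metric_triangle _ w _))//.
  by rewrite ltrD// metric_sym.
have cx : cauchy (x @ \oo).
  apply/cauchy_mdistP => e e0.
  have [|N Ne] := epslt (e / 2); first by rewrite divr_gt0.
  exists N => m n Nm Nn; rewrite (lt_le_trans (xmn _ _))// (splitr e) lerD//.
    by rewrite (le_trans (epsle _ _ Nm))// ltW.
  by rewrite (le_trans (epsle _ _ Nn))// ltW.
exists (class_of_seq (cauchy_seq cx)).
apply/fcvgrPdist_lt => e e0.
have e2 : 0 < e / 2 by rewrite divr_gt0.
have [N Ne] := epslt _ e2.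
have [N' Nx] := completion_inc_cvg (cauchy_seq cx) e2.
apply: filterS (xF (maxn N N')) => w; rewrite ballEmdist /= => xw.
rewrite (le_lt_trans (metric_triangle _ (completion_inc (x (maxn N N'))) _))//.
rewrite (splitr e) ler_ltD//.
  by rewrite metric_sym (Nx (maxn N N'))// leq_maxr.
rewrite (lt_le_trans xw)// (le_trans (epsle _ _ (leq_maxl N N')))//.
exact: ltW.
Qed.

End Completion.

Section Factorization.
Context (R : realType) (M E : metricType R) (T : M -> E) (K : R) (hK : 0 < K).

Definition factor_dist (x y : M) : R := K^-1 * mdist (T x) (T y).

Let factor_distxx x : factor_dist x x = 0.
Proof. by rewrite /factor_dist mdistxx mulr0. Qed.

Let factor_dist_sym x y : factor_dist x y = factor_dist y x.
Proof. by rewrite /factor_dist metric_sym. Qed.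

Let factor_dist_triangle y x z :
  factor_dist x z <= factor_dist x y + factor_dist y z.
Proof.
by rewrite /factor_dist -mulrDr ler_pM2l ?invr_gt0// metric_triangle.
Qed.

Definition factor_pseudometric : pseudometric R M :=
  Pseudometric factor_distxx factor_dist_sym factor_dist_triangle.

Definition factor_quotient : Type := metric_quotient factor_pseudometric.

HB.instance Definition _ := Metric.on factor_quotient.

Definition factor_space : Type := completion factor_quotient.

HB.instance Definition _ := Metric.on factor_space.

Lemma factor_space_complete : complete_metric factor_space.
Proof. exact: completion_complete. Qed.

Definition factor_class (x : M) : factor_quotient :=
  quotient_class factor_pseudometric x.

Definition factor_inc (x : M) : factor_space := completion_inc (factor_class x).

Lemma mdist_factor_inc x y :
  mdist (factor_inc x) (factor_inc y) = K^-1 * mdist (T x) (T y).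
Proof. by rewrite completion_inc_isometry mdist_class. Qed.

Lemma factor_inc_lipschitz : is_lipschitz K T -> is_lipschitz 1 factor_inc.
Proof.
move=> [bT minT]; split=> [x y|K' bK'].
  by rewrite mdist_factor_inc mul1r ler_pdivrMl.
rewrite -(ler_pM2l hK) mulr1; apply: minT => x y.
by rewrite -mulrA -ler_pdivrMl// -mdist_factor_inc.
Qed.

Lemma factor_inc_inclusion_quotient : inclusion_quotient factor_inc.
Proof.
split; last first.
  exists (pdist0_equiv factor_pseudometric) => x y; rewrite /= /pdist0.
  split=> [/eqP xy|xy]; first by apply: mdist_positivity; rewrite mdist_factor_inc.
  by apply/eqP; rewrite /= /factor_dist -mdist_factor_inc xy mdistxx.
rewrite (_ : range _ = range (@completion_inc _ factor_quotient)).
  exact: completion_inc_dense.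
apply/seteqP; split=> _ [p _ <-]; first by exists (factor_class p).
by exists (quotient_repr p) => //; rewrite /factor_inc /factor_class quotient_reprK.
Qed.

Definition factor_map (p : factor_quotient) : E := T (quotient_repr p).

Lemma factor_mapE x : factor_map (factor_class x) = T x.
Proof.
apply: mdist_positivity; apply/eqP.
have /eqP := pdist_repr factor_pseudometric x.
by rewrite /= /factor_dist mulf_eq0 invr_eq0 gt_eqF.
Qed.

Lemma mdist_factor_map p q :
  mdist (factor_map p) (factor_map q) = K * mdist p q.
Proof.
rewrite -[p in RHS]quotient_reprK -[q in RHS]quotient_reprK mdist_class /=.
by rewrite /factor_dist mulrA divff ?mul1r// gt_eqF.
Qed.

Lemma factor_ext_subproof : complete_metric E -> exists Tb : factor_space -> E,
  continuous Tb /\ forall p, Tb (completion_inc p) = factor_map p.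
Proof.
move=> hE.
have /choice[Tb TbP] (z : factor_space) : exists l, forall e, 0 < e -> exists2 r,
    0 < r & forall p, mdist (completion_inc p) z < r -> mdist l (factor_map p) < e.
  have [u zu] := completion_classP z.
  have cu : cauchy ((factor_map \o seq_of u) @ \oo).
    apply/cauchy_mdistP => e e0.
    have eK : 0 < e / K by rewrite divr_gt0.
    have [N Nu] := (cauchy_mdistP _).1 (seq_cauchy u) _ eK.
    exists N => m n Nm Nn /=.
    by rewrite mdist_factor_map mulrC -ltr_pdivlMr// Nu.
  have [l ul] := hE _ _ cu; exists l => e e0.
  have e2 : 0 < e / 2 by rewrite divr_gt0.
  have r0 : 0 < e / 2 / K / 2 by rewrite !divr_gt0.
  exists (e / 2 / K / 2) => // p pz.
  have [N Nu] := completion_inc_cvg u r0.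
  have [N' _ N'u] := (cvgrPdist_lt (factor_map \o seq_of u) l).1 ul _ e2.
  set n := maxn N N'.
  rewrite (le_lt_trans (metric_triangle _ (factor_map (seq_of u n)) _))//.
  rewrite (splitr e) ltrD//; first by apply: N'u; rewrite /= leq_maxr.
  rewrite mdist_factor_map mulrC -ltr_pdivlMr// -completion_inc_isometry.
  rewrite (le_lt_trans (metric_triangle _ z _))// addrC [ltRHS]splitr ltr_leD//.
    by rewrite zu metric_sym -zu; exact: pz.
  by rewrite zu Nu// leq_maxl.
exists Tb; split=> [z|p]; last first.
  apply/esym/mdist_positivity/eqP; rewrite eq_le mdist_ge0 andbT.
  apply/ler_addgt0Pl => e e0; rewrite addr0 ltW// metric_sym.
  by have [r r0 ->//] := TbP (completion_inc p) _ e0; rewrite mdistxx.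
apply/(@cvgrPdist_lt _ _ _ _ (nbhs_filter z)) => e e0.
have e2 : 0 < e / 2 by rewrite divr_gt0.
have [r r0 zr] := TbP z _ e2.
apply/nbhs_ballP; exists r => // w; rewrite ballEmdist /= => zw.
have [s s0 ws] := TbP w _ e2.
have m0 : 0 < Num.min s (r - mdist z w) by rewrite lt_min s0 subr_gt0.
have [p] := completion_inc_approx w m0; rewrite lt_min => /andP[ps pr].
rewrite (le_lt_trans (metric_triangle _ (factor_map p) _))// (splitr e) ltrD//.
  rewrite zr// (le_lt_trans (metric_triangle _ w _))// -ltrBrDr.
  by rewrite (metric_sym w).
by rewrite metric_sym ws.
Qed.

Definition factor_ext (hE : complete_metric E) : factor_space -> E :=
  sval (cid (factor_ext_subproof hE)).

Section Extension.
Context (hE : complete_metric E).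

Lemma factor_ext_continuous : continuous (factor_ext hE).
Proof. by rewrite /factor_ext; case: cid => Tb []. Qed.

Lemma factor_extE p : factor_ext hE (completion_inc p) = factor_map p.
Proof. by rewrite /factor_ext; case: cid => Tb []. Qed.

Lemma factor_ext_unique (g : factor_space -> E) : continuous g ->
  (forall p, g (completion_inc p) = factor_map p) -> g = factor_ext hE.
Proof.
move=> gc gE; apply/funext => z; apply/mdist_positivity/eqP.
rewrite eq_le mdist_ge0 andbT; apply/ler_addgt0Pl => e e0; rewrite addr0.
have e2 : 0 < e / 2 by rewrite divr_gt0.
have /nbhs_ballP[r /= r0 zr] :
    \forall w \near z, mdist (g z) (g w) < e / 2.
  by have /cvgrPdist_lt := gc z; apply.
have /nbhs_ballP[s /= s0 zs] :
    \forall w \near z, mdist (factor_ext hE z) (factor_ext hE w) < e / 2.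
  by have /cvgrPdist_lt := @factor_ext_continuous z; apply.
have m0 : 0 < Num.min r s by rewrite lt_min r0 s0.
have [p] := completion_inc_approx z m0; rewrite lt_min => /andP[pr ps].
have /zr gp : ball z r (completion_inc p) by rewrite ballEmdist /= metric_sym.
have /zs fp : ball z s (completion_inc p) by rewrite ballEmdist /= metric_sym.
rewrite ltW// (le_lt_trans (metric_triangle _ (factor_map p) _))//.
rewrite (splitr e) ltrD//; first by rewrite -gE.
by rewrite metric_sym -factor_extE.
Qed.

Lemma mdist_factor_ext z w :
  mdist (factor_ext hE z) (factor_ext hE w) = K * mdist z w.
Proof.
apply/eqP; rewrite -subr_eq0 -normr_le0; apply/ler_addgt0Pl => e e0.
rewrite addr0.
have approx v (s : R) : 0 < s -> exists2 p, mdist v (completion_inc p) < s &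
    mdist (factor_ext hE v) (factor_map p) < s.
  move=> s0; have /nbhs_ballP[t /= t0 vt] :
      \forall u \near v, mdist (factor_ext hE v) (factor_ext hE u) < s.
    by have /cvgrPdist_lt := @factor_ext_continuous v; apply.
  have m0 : 0 < Num.min t s by rewrite lt_min t0 s0.
  have [p] := completion_inc_approx v m0; rewrite lt_min => /andP[pt ps].
  exists p; first by rewrite metric_sym.
  by rewrite -factor_extE; apply: vt; rewrite ballEmdist /= metric_sym.
pose s := e / (1 + K) / 2.
have K1 : 0 < 1 + K by rewrite addr_gt0.
have s0 : 0 < s by rewrite !divr_gt0.
have [p zp fzp] := approx z _ s0; have [q wq fwq] := approx w _ s0.
have pq : mdist (factor_map p) (factor_map q) =
    K * mdist (completion_inc p) (completion_inc q).
  by rewrite mdist_factor_map completion_inc_isometry.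
rewrite -(subrKA (mdist (factor_map p) (factor_map q))).
rewrite (le_trans (ler_normD _ _))// {2}pq -mulrBr normrM gtr0_norm//.
have -> : e = (s + s) + K * (s + s).
  by rewrite -splitr -[X in X + _]mul1r -mulrDl mulrC divfK// gt_eqF.
rewrite lerD//; first by rewrite (le_trans (mdist_quad _ _ _ _))// lerD// ltW.
rewrite ler_pM2l// (le_trans (mdist_quad _ _ _ _))//.
by rewrite ![mdist (completion_inc _) _]metric_sym lerD// ltW.
Qed.

Lemma factor_ext_lipschitz : is_lipschitz K T -> is_lipschitz K (factor_ext hE).
Proof.
move=> [bT minT]; split=> [z w|K' bK']; first by rewrite mdist_factor_ext.
rewrite leNgt; apply/negP => K'K.
have bT0 : lipschitz_bound 0 T.
  move=> x y; rewrite mul0r leNgt; apply/negP => Txy.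
  have := bK' (factor_inc x) (factor_inc y).
  rewrite mdist_factor_ext ler_pM2r ?leNgt ?K'K//.
  by rewrite mdist_factor_inc mulr_gt0// invr_gt0.
by have := minT _ bT0; rewrite leNgt hK.
Qed.

Lemma factor_ext_inc : factor_ext hE \o factor_inc = T.
Proof. by apply/funext => x; rewrite /= factor_extE factor_mapE. Qed.

End Extension.
End Factorization.

Arguments factor_ext {R M E} T {K} hK hE _.

(* Main.v *)
Require Import Defs.
From mathcomp Require Import all_boot all_order all_algebra.
From mathcomp Require Import all_classical all_reals all_analysis.

(** The extended map [factor_ext T hK hE], called [Tb] here, multiplies all
    distances by [K].  Hence it is injective, and since its domain is complete
    its range is closed in [E].  That range contains [T x = T0 (i0 x)] for every
    [x], the points [i0 x] are dense in [J] and [T0] is continuous, so [T0]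
    takes all its values in the range of [Tb].  Therefore [Tb \o i = T0] has
    exactly one solution [i], namely [T0] followed by the inverse of [Tb].

    The remaining properties are read off this equation.  Cancelling [Tb] in
    [Tb \o i \o i0 = T = Tb \o factor_inc] gives [i \o i0 = factor_inc], and
    so [range i] contains the dense set [range factor_inc].  Because [Tb]
    scales distances by exactly [K], a number [k] is a Lipschitz bound for [i]
    if and only if [K * k] is one for [T0], so that the best constant of [i] is
    [1] when that of [T0] is [K]. *)

Import Order.TTheory GRing.Theory Num.Theory.
Import metricType_numDomainType.

Local Open Scope classical_set_scope.
Local Open Scope ring_scope.

Section ScaledIsometry.
Context (R : realType) (X Y : metricType R) (K : R) (f : X -> Y).
Hypotheses (K0 : 0 < K)
  (fK : forall a b, mdist (f a) (f b) = K * mdist a b).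

Lemma scaled_isometry_inj : injective f.
Proof.
move=> a b fab; apply: mdist_positivity; apply/eqP.
have /eqP := fK a b.
by rewrite fab mdistxx eq_sym mulf_eq0 gt_eqF.
Qed.

Lemma lipschitz_bound_scaled_comp (W : metricType R) (g : W -> X) (k : R) :
  lipschitz_bound (K * k) (f \o g) <-> lipschitz_bound k g.
Proof.
split=> gk a b; last by rewrite /= fK -mulrA ler_pM2l.
by rewrite -(ler_pM2l K0) -fK mulrA; exact: gk.
Qed.

(** The traces on [X] of the balls around a point adherent to the range form a
    Cauchy filter, because points of [X] with close images are close; the image
    of its limit is that point. *)
Lemma closed_range_scaled_isometry : complete_metric X -> closed (range f).
Proof.
move=> cX y yf.
pose F := filter_from [set e : R | 0 < e] (fun e => f @^-1` ball y e).
have FF : ProperFilter F.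
  apply: filter_from_proper.
    apply: filter_from_filter; first by exists 1; rewrite /= ltr01.
    move=> a b /= a0 b0; exists (Num.min a b); first by rewrite /= lt_min a0 b0.
    by move=> x; rewrite /= !ballEmdist /= lt_min => /andP[].
  move=> e /= e0; have [_ [[x _ <-] yx]] := yf _ (nbhsx_ballx y e e0).
  by exists x.
have [|l Fl] := cX F FF.
  apply/cauchy_ballP => e e0; have r0 : 0 < K * e / 2 by rewrite divr_gt0// mulr_gt0.
  pose A := f @^-1` ball y (K * e / 2).
  exists (A, A); first by split; exists (K * e / 2).
  move=> [a b] [/=]; rewrite /A /= !ballEmdist /= => ya yb.
  rewrite -(ltr_pM2l K0) -fK (le_lt_trans (metric_triangle _ y _))//.
  by rewrite (splitr (K * e)) ltrD// metric_sym.
exists l => //; apply: mdist_positivity; apply/eqP.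
rewrite eq_le mdist_ge0 andbT; apply/ler_addgt0Pl => e e0; rewrite addr0.
have e2 : 0 < e / 2 by rewrite divr_gt0.
have Fy : F (f @^-1` ball y (e / 2)) by exists (e / 2).
have Fb : F (ball l (e / 2 / K)) by apply: Fl; apply: nbhsx_ballx; rewrite divr_gt0.
have [x [/=]] := filter_ex (filterI Fy Fb).
rewrite !ballEmdist /= => yx lx.
rewrite ltW// (le_lt_trans (metric_triangle _ (f x) _))// (splitr e) ltrD//.
  by rewrite fK mulrC -ltr_pdivlMr.
by rewrite metric_sym.
Qed.

End ScaledIsometry.

Lemma lipschitz_bound_continuous (R : realType) (X Y : metricType R) (k : R)
  (f : X -> Y) : 0 < k -> lipschitz_bound k f -> continuous f.
Proof.
move=> k0 fk x; apply/(@cvgrPdist_lt _ _ _ _ (nbhs_filter x)) => e e0.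
apply/nbhs_ballP; exists (e / k) => /=; first by rewrite divr_gt0.
move=> y; rewrite ballEmdist /= => xy.
by rewrite (le_lt_trans (fk _ _))// mulrC -ltr_pdivlMr.
Qed.

Lemma dense_subset (X : topologicalType) (A B : set X) :
  A `<=` B -> dense A -> dense B.
Proof. by move=> AB dA O O0 Oo; have [x [Ox /AB]] := dA O O0 Oo; exists x. Qed.

Lemma closed_dense_setT (X : topologicalType) (A : set X) :
  closed A -> dense A -> A = setT.
Proof.
move=> cA dA; apply/seteqP; split=> // x _; apply: contrapT => nAx.
have [||y [nAy /nAy//]] := dA (~` A); first by exists x.
exact: closed_openC.
Qed.

Theorem theorem2p2 (R : realType) (M E : metricType R) (K : R) (T : M -> E)
    (hE : complete_metric E) (hK : 0 < K) (hT : is_lipschitz K T)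
    (J : metricType R) (hJ : complete_metric J)
    (T0 : J -> E) (i0 : M -> J)
    (hfact : T = T0 \o i0)
    (hT0 : is_lipschitz K T0)
    (hi0 : is_lipschitz 1 i0) (qi0 : inclusion_quotient i0)
    (di0 : dense (range i0)) :
  exists i : J -> factor_space T hK,
    [/\ is_lipschitz 1 i,
        inclusion_quotient i,
        i \o i0 = factor_inc T hK
      & factor_ext T hK hE \o i = T0].
Proof.
have [T0K minT0] := hT0.
pose Tb := factor_ext T hK hE.
have TbK : forall a b, mdist (Tb a) (Tb b) = K * mdist a b.
  exact: mdist_factor_ext.
have TbE x : Tb (factor_inc T hK x) = T0 (i0 x).
  rewrite -[RHS]/((T0 \o i0) x) -hfact.
  by have /(congr1 (@^~ x)) := factor_ext_inc T hK hE.
have T0_range : T0 @^-1` range Tb = setT.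
  apply: closed_dense_setT.
    apply: closed_comp.
      by move=> z _; exact: lipschitz_bound_continuous hK T0K z.
    exact: closed_range_scaled_isometry hK TbK (@factor_space_complete _ _ _ T _ hK).
  apply: dense_subset di0 => _ [x _ <-].
  by exists (factor_inc T hK x).
have /choice[i Tbi] z : exists w, Tb w = T0 z.
  by have [w _ wz] : (T0 @^-1` range Tb) z by [rewrite T0_range]; exists w.
have iT0 : Tb \o i = T0 by exact/funext.
have ij : i \o i0 = factor_inc T hK.
  apply/funext => x; apply: (scaled_isometry_inj _ _ _ _ _ hK TbK).
  by rewrite /= Tbi TbE.
have boundP k : lipschitz_bound (K * k) T0 <-> lipschitz_bound k i.
  by rewrite -iT0; exact: lipschitz_bound_scaled_comp.
exists i; split=> //.
- split=> [|k /boundP /minT0]; first by apply/boundP; rewrite mulr1.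
  by rewrite -{1}(mulr1 K) ler_pM2l.
- split.
    apply: dense_subset (factor_inc_inclusion_quotient T hK).1.
    by move=> _ [x _ <-]; exists (i0 x) => //; rewrite -ij.
  pose r : rel J := fun x y => i x == i y.
  have rr : reflexive r by move=> x; exact: eqxx.
  have rs : symmetric r by move=> x y; exact: eq_sym.
  have rt : transitive r by move=> y x z /eqP xy /eqP yz; apply/eqP; rewrite xy.
  by exists (EquivRel r rr rs rt) => x y; split=> /eqP.
Qed.
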